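(* Let $\mathcal V$ be a variety of $R$-modules expanded by multilinear operations named by $F$ and let $(Q,I)$ be datum in $\mathcal V$. The set of equivalence classes of extensions of $Q$ by $I$ in the variety $\mathcal V$ is in bijective correspondence with $H^2_{\mathcal V}(Q,I)$. The equivalence class of a semidirect product corresponds to an equivalence class of a 2-cocycle with only action terms (i.e. all factor sets are zero).
   Context: $R$ is a fixed ring, $F$ a set of operation symbols of finite positive arities $\mathrm{ar} f$, and ${}_R\mathcal M_F$ is the variety of all $R$-modules expanded by an $R$-multilinear operation for each $f\in F$, in the signature $\{+,-,0\}\cup R\cup F$. A variety of $R$-modules expanded by multilinear operations is a subvariety $\mathcal V$ of ${}_R\mathcal M_F$; $\mathrm{Id}\,\mathcal V$ is its set of identities. Datum in $\mathcal V$: a pair $(Q,I)$ with $Q,I\in\mathcal V$. $[n]=\{1,\dots,n\}$, $[n]^\ast$ is the set of nonempty proper subsets of $[n]$; $\vec q_s[\vec p]$ is $\vec q$ with the coordinates in $s$ replaced by those of $\vec p$. An action $Q\ast I$ is a family of operations $a(f,s):Q^n\times I^n\to I$, one for each $f\in F$ with $n=\mathrm{ar} f$ and each $s\in[n]^\ast$. A 2-cocycle $T$ for $(Q,I)$ consists of factor sets $T_+:Q^2\to I$, $T_r:Q\to I$ $(r\in R)$, $T_f:Q^{\mathrm{ar} f}\to I$ $(f\in F)$ with $T_+(x,0)=T_+(0,x)=0$, $T_r(0)=0$, $T_f(\vec x)=0$ if some $x_i=0$, and an action with operations $a(f,s)$ (the action terms of $T$), where $a(f,s)(\vec q,\vec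 a)$ depends only on $q_j$ ($j\notin s$) and $a_j$ ($j\in s$), is $R$-multilinear in the $a_j$, $j\in s$, and vanishes if $q_j=0$ for some $j\notin s$. The algebra $I\rtimes_TQ$ has universe $I\times Q$ and $\langle a,x\rangle+\langle b,y\rangle=\langle a+b+T_+(x,y),x+y\rangle$, $-\langle a,x\rangle=\langle -a-T_+(x,-x),-x\rangle$, $r\cdot\langle a,x\rangle=\langle r\cdot a+T_r(x),r\cdot x\rangle$, $F_f(\langle a_1,x_1\rangle,\dots,\langle a_n,x_n\rangle)=\langle f^I(\vec a)+\sum_{s\in[n]^\ast}a(f,s)(\vec x,\vec a)+T_f(\vec x),f^Q(\vec x)\rangle$. For a term $t$, write its interpretation in $I\rtimes_TQ$ as $\langle t^I(\vec a)+D^T_t(\vec a,\vec q),t^Q(\vec q)\rangle$; $T$ is $\mathcal V$-compatible if $D^T_t=D^T_s$ for all $t=s\in\mathrm{Id}\,\mathcal V$. A 2-coboundary for $(Q,I)$ is a sequence $G=\{G_+,G_r,G_f,g(f,s): r\in R, f\in F, s\in[\mathrm{ar} f]^\ast\}$ such that there exist an action $Q\ast I$, with operations $c(f,s)$, and a function $h:Q\to I$ with $h(0)=0$ satisfying, with $n=\mathrm{ar} f$: $G_+(x,y)=h(x)+h(y)-h(x+y)$; $G_r(x)=r\cdot h(x)-h(r\cdot x)$; $G_f(\vec x)=\sum_{s\in[n]^\ast}(-1)^{1+|s|}c(f,s)(\vec x,h(\vec x))+(-1)^{1+n}f^I(h(\vec x))-h(f^Q(\vec x))$; $g(f,s)(\vec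 x,\vec a)=\sum_{s\subsetneq r\in[n]^\ast}(-1)^{1+|r|-|s|}c(f,r)(\vec x,h(\vec x)_s[\vec a])+(-1)^{1+n-|s|}f^I(h(\vec x)_s[\vec a])$. $B^2(Q,I)$ is the set of 2-coboundaries. 2-cocycles $T,T'$ for $(Q,I)$ are equivalent, $T\sim T'$, if $T-T'\in B^2(Q,I)$, the difference being taken entrywise (factor sets and action terms). $H^2_{\mathcal V}(Q,I)$ is the set of $\mathcal V$-compatible 2-cocycles of $(Q,I)$ modulo equivalence. An extension of $Q$ by $I$ in $\mathcal V$ is an exact sequence $0\to I\stackrel{i}{\to}M\stackrel{\pi}{\to}Q\to0$ of algebras in $\mathcal V$; two such, with middle terms $M,M'$ and maps $(i,\pi),(i',\pi')$, are equivalent if there is an isomorphism $\lambda:M\to M'$ with $\lambda\circ i=i'$, $\pi'\circ\lambda=\pi$. An extension is a semidirect product if there is a homomorphism $l:Q\to M$ with $\pi\circ l=\mathrm{id}_Q$.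
   Formalization: Two 2-cocycles T, T' are called equivalent when T − T' is a 2-coboundary witnessed by the action of T itself, rather than by an arbitrary action; with an arbitrary action the claim fails (R = F_2, one binary f, Q = I = F_2 with f = 0: 6 extension classes but 4 cohomology classes). *)

(* Defs.v *)
From HB Require Import structures.
From mathcomp Require Import all_boot all_order all_algebra.

Set Implicit Arguments.
Unset Strict Implicit.
Unset Printing Implicit Defensive.

Import GRing.Theory.

Local Open Scope ring_scope.

(* Quotient of [T] by the relation [r]: the type of the classes [r x].
    Sets are written as predicates because the type of classes of extensions
    lives in a universe too large for [set] and [{eq_quot _}]. *)

Definition quotient (T : Type) (r : T -> T -> Prop) : Type :=
  {C : T -> Prop | exists x, C = r x}.

Definition class (T : Type) (r : T -> T -> Prop) (x : T) : quotient r :=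
  exist (fun C => exists y, C = r y) (r x) (ex_intro _ x erefl).

Section Signature.
Variables (R : pzRingType) (F : Type) (ar : F -> nat).

Inductive term : Type :=
| Var of nat
| Zero
| Add of term & term
| Opp of term
| Scale of R & term
| Op (f : F) of ('I_(ar f) -> term).

(* No equation is assumed: [rtimes T], the algebra I x|_T Q, has this type for
   every [T], compatible or not. *)
Record alg : Type := Alg {
  carrier :> Type;
  azero : carrier;
  aadd : carrier -> carrier -> carrier;
  aopp : carrier -> carrier;
  ascale : R -> carrier -> carrier;
  aop : forall f : F, ('I_(ar f) -> carrier) -> carrier
}.

Fixpoint eval (A : alg) (env : nat -> A) (t : term) : A :=
  match t with
  | Var k => env k
  | Zero => azero A
  | Add t1 t2 => aadd (eval env t1) (eval env t2)
  | Opp t1 => aopp (eval env t1)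
  | Scale r t1 => ascale r (eval env t1)
  | Op f ts => aop (fun i => eval env (ts i))
  end.

Definition satisfies (A : alg) (e : term * term) : Prop :=
  forall env : nat -> A, eval env e.1 = eval env e.2.

Record is_hom (A B : alg) (phi : A -> B) : Prop := IsHom {
  hom_zero : phi (azero A) = azero B;
  hom_add : forall x y, phi (aadd x y) = aadd (phi x) (phi y);
  hom_opp : forall x, phi (aopp x) = aopp (phi x);
  hom_scale : forall r x, phi (ascale r x) = ascale r (phi x);
  hom_op : forall (f : F) (x : 'I_(ar f) -> A),
    phi (aop x) = aop (fun i => phi (x i))
}.

Definition linear_at (n : nat) (M N : lmodType R) (g : ('I_n -> M) -> N)
    (i : 'I_n) : Prop :=
  forall x : 'I_n -> M, linear (fun u : M => g [eta x with i |-> u]).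

Record malg : Type := MAlg {
  mmod :> lmodType R;
  mop : forall f : F, ('I_(ar f) -> mmod) -> mmod;
  mop_multilinear : forall (f : F) (i : 'I_(ar f)), linear_at (@mop f) i
}.

Definition alg_of (M : malg) : alg :=
  @Alg M 0 +%R -%R *:%R (@mop M).
Coercion alg_of : malg >-> alg.

Definition is_variety (V : malg -> Prop) : Prop :=
  exists E : term * term -> Prop,
    forall A : malg, V A <-> (forall e, E e -> satisfies A e).

Definition Id (V : malg -> Prop) (e : term * term) : Prop :=
  forall A : malg, V A -> satisfies A e.

(* the set [n]^* of nonempty proper subsets of 'I_n *)
Definition pset (n : nat) : Type :=
  {s : {set 'I_n} | (s != set0) && (s != [set: 'I_n])}.

(* q_s[p] *)
Definition subst (n : nat) (T : Type) (q : 'I_n -> T) (s : {set 'I_n})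
    (p : 'I_n -> T) : 'I_n -> T :=
  fun i => if i \in s then p i else q i.

Section Datum.
Variables Q I : malg.

Definition action : Type :=
  forall f : F, pset (ar f) -> ('I_(ar f) -> Q) -> ('I_(ar f) -> I) -> I.

(* A family of factor sets and action terms, not subject to any condition. *)
Record cochain : Type := Cochain {
  cadd : Q -> Q -> I;
  cscale : R -> Q -> I;
  cop : forall f : F, ('I_(ar f) -> Q) -> I;
  cact : action
}.

Definition cochain_sub (T T' : cochain) : cochain :=
  {| cadd := fun x y => cadd T x y - cadd T' x y;
     cscale := fun r x => cscale T r x - cscale T' r x;
     cop := fun f x => cop T x - cop T' x;
     cact := fun f s q a => cact T s q a - cact T' s q a |}.

Record is_cocycle (T : cochain) : Prop := IsCocycle {
  cadd0 : forall x, cadd T x 0 = 0;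
  c0add : forall x, cadd T 0 x = 0;
  cscale0 : forall r, cscale T r 0 = 0;
  cop0 : forall f (x : 'I_(ar f) -> Q), (exists i, x i = 0) -> cop T x = 0;
  cact_dep : forall f (s : pset (ar f)) (q q' : 'I_(ar f) -> Q)
      (a a' : 'I_(ar f) -> I),
    (forall j, j \notin val s -> q j = q' j) ->
    (forall j, j \in val s -> a j = a' j) ->
    cact T s q a = cact T s q' a';
  cact_multilinear : forall f (s : pset (ar f)) (q : 'I_(ar f) -> Q) j,
    j \in val s -> linear_at (cact T s q) j;
  cact0 : forall f (s : pset (ar f)) (q : 'I_(ar f) -> Q) (a : 'I_(ar f) -> I),
    (exists2 j, j \notin val s & q j = 0) -> cact T s q a = 0
}.

Definition rtimes (T : cochain) : alg :=
  @Alg (I * Q)%type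
    (0, 0)
    (fun u v => (u.1 + v.1 + cadd T u.2 v.2, u.2 + v.2))
    (fun u => (- u.1 - cadd T u.2 (- u.2), - u.2))
    (fun r u => (r *: u.1 + cscale T r u.2, r *: u.2))
    (fun f u =>
       let a := fun i => (u i).1 in
       let x := fun i => (u i).2 in
       (mop a + \sum_(s : pset (ar f)) cact T s x a + cop T x, mop x)).

Definition Dterm (T : cochain) (t : term) (a : nat -> I) (q : nat -> Q) : I :=
  (eval (A := rtimes T) (fun k => (a k, q k)) t).1 - eval (A := I) a t.

Definition compatible (V : malg -> Prop) (T : cochain) : Prop :=
  forall e, Id V e -> forall a q, Dterm T e.1 a q = Dterm T e.2 a q.

Definition coboundary (c : action) (h : Q -> I) : cochain :=
  {| cadd := fun x y => h x + h y - h (x + y);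
     cscale := fun r x => r *: h x - h (r *: x);
     cop := fun f x =>
       let n := ar f in
       let hx := fun i => h (x i) in
       \sum_(s : pset n) (-1) ^+ (1 + #|val s|) *: c f s x hx
       + (-1) ^+ (1 + n) *: mop hx - h (mop x);
     cact := fun f s x a =>
       let n := ar f in
       let hxa := subst (fun i => h (x i)) (val s) a in
       \sum_(r : pset n | val s \proper val r)
           (-1) ^+ (1 + #|val r| - #|val s|) *: c f r x hxa
       + (-1) ^+ (1 + n - #|val s|) *: mop hxa |}.

(* The 2-coboundaries witnessed by the action [c]; B^2(Q, I) is their union
   over all [c]. *)
Definition is_coboundary (c : action) (G : cochain) : Prop :=
  exists h : Q -> I, h 0 = 0 /\ G = coboundary c h.

(* The action witnessing that [T - T'] is a 2-coboundary is the action of [T]: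
   this is what the expansion of the operations along <a, x> |-> <a - h(x), x>
   from [I x|_T' Q] to [I x|_T Q] produces. If it were unrelated to [T] and
   [T'], inequivalent extensions would be identified: for a binary f with
   f^I = 0, f^Q = 0 and h linear, T_f could be altered by an arbitrary
   c_1(h(x), y) + c_2(x, h(y)) while the actions are left unchanged. *)
Definition cochain_equiv (T T' : cochain) : Prop :=
  is_coboundary (cact T) (cochain_sub T T').

Record compatible_cocycle (V : malg -> Prop) : Type := CompatibleCocycle {
  cocycle :> cochain;
  cocycleP : is_cocycle cocycle;
  cocycle_compatible : compatible V cocycle
}.

Definition cocycle_equiv (V : malg -> Prop) (T T' : compatible_cocycle V) :
    Prop :=
  cochain_equiv T T'.

Definition H2 (V : malg -> Prop) : Type := quotient (@cocycle_equiv V).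

Definition cohomology_class (V : malg -> Prop) (T : compatible_cocycle V) :
    H2 V :=
  class (@cocycle_equiv V) T.

Definition only_action_terms (T : cochain) : Prop :=
  [/\ forall x y, cadd T x y = 0,
      forall r x, cscale T r x = 0 &
      forall f (x : 'I_(ar f) -> Q), cop T x = 0].

Record extension (V : malg -> Prop) : Type := Extension {
  mid : malg;
  incl : I -> mid;
  proj : mid -> Q;
  ext_mid : V mid;
  ext_incl_hom : is_hom (A := I) (B := mid) incl;
  ext_proj_hom : is_hom (A := mid) (B := Q) proj;
  ext_incl_inj : injective incl;
  ext_exact : forall m, proj m = 0 <-> exists a, incl a = m;
  ext_proj_surj : forall x, exists m, proj m = x
}.

Definition isomorphic_under_over (M M' : alg) (i : I -> M) (p : M -> Q)
    (i' : I -> M') (p' : M' -> Q) : Prop :=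
  exists l : M -> M', [/\ is_hom l, bijective l,
    forall a, l (i a) = i' a & forall m, p' (l m) = p m].

Definition extension_equiv (V : malg -> Prop) (E E' : extension V) : Prop :=
  isomorphic_under_over (M := mid E) (M' := mid E')
    (@incl V E) (@proj V E) (@incl V E') (@proj V E').

Definition extension_classes (V : malg -> Prop) : Type :=
  quotient (@extension_equiv V).

Definition extension_class (V : malg -> Prop) (E : extension V) :
    extension_classes V :=
  class (@extension_equiv V) E.

Definition is_semidirect (V : malg -> Prop) (E : extension V) : Prop :=
  exists l : Q -> mid E, is_hom (A := Q) (B := mid E) l /\ forall x, proj (l x) = x.

(* I -> I x|_T Q -> Q, with a |-> <a, 0> and <a, x> |-> x, is equivalent to E *)
Definition realizes (V : malg -> Prop) (T : cochain) (E : extension V) : Prop :=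
  isomorphic_under_over (M := rtimes T) (M' := mid E) (fun a => (a, 0)) snd
    (@incl V E) (@proj V E).

End Datum.
End Signature.

(* Main.v *)
From HB Require Import structures.
Require Import Defs.
From mathcomp Require Import all_boot all_order all_algebra.
From mathcomp Require Import boolp.

(** An extension E = (I -i-> M -p-> Q) and a 2-cocycle T are matched as soon as
    I x|_T Q is equivalent to E.  This is the same as giving a section sigma of
    p with sigma(0) = 0 whose failure to be a homomorphism is measured by T
    ([section_cocycle], [realizesP]): the factor sets are the defects of sigma,
    e.g. T_+(x,y) = sigma(x) + sigma(y) - sigma(x + y), and the action term
    a(f,s)(x,a) is f^M evaluated at i(a_j) for j in s and at sigma(x_j) for j
    outside s.  The equivalence is <a,x> |-> i(a) + sigma(x); that it preserves
    f is the expansion of f^M(sigma(x) + i(a)) over all subsets s of the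
    arguments ([multilinear_expand]), where the empty and the full set
    contribute f^M(sigma(x)) and i(f^I(a)).  These are two different sets
    because arities are positive; positivity is also what makes f vanish at 0.

    Every normalized section has such a cocycle ([exists_section_cocycle]), so
    every extension is matched with some T, and T is compatible because the
    identities of the variety hold in both M and I.  Conversely, if T is a
    compatible cocycle, then I x|_T Q satisfies every identity of the variety.
    The module axioms and the multilinearity of the operations are among these
    identities, so I x|_T Q is a member of the variety
    ([malg_of_identities], [exists_realization]).

    Two sections of the same extension differ by i o h for some h : Q -> I, and
    expanding f^M along sigma' = sigma - i o h turns the difference of their
    cocycles into exactly the coboundary of h along the action terms of T
    ([section_cocycle_sub]).  Hence, if T is matched with E, the cocycles
    matched with E are exactly those equivalent to T, whereas the extensions
    matched with T are exactly those equivalent to E.  Such a relation induces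
    a bijection between the classes ([quotient_bijection]).  Finally, the
    factor sets attached to sigma vanish iff sigma is a homomorphism. *)

Set Implicit Arguments.
Unset Strict Implicit.
Unset Printing Implicit Defensive.

Import GRing.Theory.

Local Open Scope ring_scope.

(** * Bijections between quotients *)

(** Neither relation is assumed to be an equivalence: the last two hypotheses
    force two points related to a common one to have the same class. *)
Lemma quotient_bijection (A B : Type) (rA : A -> A -> Prop)
    (rB : B -> B -> Prop) (rel : A -> B -> Prop) :
  (forall a, exists b, rel a b) -> (forall b, exists a, rel a b) ->
  (forall a b, rel a b -> forall a', rel a' b <-> rA a a') ->
  (forall a b, rel a b -> forall b', rel a b' <-> rB b b') ->
  exists phi : quotient rA -> quotient rB,
    bijective phi /\ forall a b, phi (class rA a) = class rB b <-> rel a b.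
Proof.
move=> relA relB relEA relEB.
have imageE a b (ab : rel a b) :
    (fun b' => exists2 a', rA a a' & rel a' b') = rB b.
  apply/funext => b'; apply/propext; split=> [[a' aa' a'b']|bb'].
    by apply/(relEB a' b) => //; apply/(relEA a b).
  by exists a; [apply/(relEA a b)|apply/(relEB a b)].
have preimageE a b (ab : rel a b) :
    (fun a' => exists2 b', rB b b' & rel a' b') = rA a.
  apply/funext => a'; apply/propext; split=> [[b' bb' a'b']|aa'].
    by apply/(relEA a b') => //; apply/(relEB a b).
  by exists b; [apply/(relEB a b)|apply/(relEA a b)].
have imageP (C : quotient rA) :
    exists b, (fun b' => exists2 a', sval C a' & rel a' b') = rB b.
  case: C => C [a eC] /=; rewrite eC; have [b ab] := relA a.
  by exists b; exact: imageE.
have preimageP (D : quotient rB) :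
    exists a, (fun a' => exists2 b', sval D b' & rel a' b') = rA a.
  case: D => D [b eD] /=; rewrite eD; have [a ab] := relB b.
  by exists a; exact: preimageE.
pose phi C : quotient rB := exist _ _ (imageP C).
pose psi D : quotient rA := exist _ _ (preimageP D).
have phiE a b : rel a b -> phi (class rA a) = class rB b.
  by move=> ab; apply: eq_exist; exact: imageE.
have psiE a b : rel a b -> psi (class rB b) = class rA a.
  by move=> ab; apply: eq_exist; exact: preimageE.
have classP T (r : T -> T -> Prop) (C : quotient r) : exists x, C = class r x.
  by case: C => C eC; case: (eC) => x Cx; exists x; exact: eq_exist.
exists phi; split; first exists psi.
- by move=> C; have [a ->] := classP _ _ C; have [b ab] := relA a;
    rewrite (phiE a b) // (psiE a b).
- by move=> D; have [b ->] := classP _ _ D; have [a ab] := relB b;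
    rewrite (psiE a b) // (phiE a b).
- move=> a b; split; last exact: phiE.
  have [b' ab'] := relA a; rewrite (phiE a b') // => /(congr1 sval)/= eB.
  apply/(relEB a b') => //; rewrite eB.
  by have [a' a'b] := relB b; apply/(relEB a' b).
Qed.

(** The subsets of A split into those avoiding i and those containing i. *)
Lemma big_subset_setD1 (N : nmodType) (T : finType) (G : {set T} -> N)
    (A : {set T}) i :
  i \in A ->
  \sum_(r : {set T} | r \subset A) G r =
  \sum_(r : {set T} | r \subset A :\ i) G r +
  \sum_(r : {set T} | r \subset A :\ i) G (i |: r).
Proof.
move=> iA; rewrite (bigID (fun r : {set T} => i \in r)) /= addrC; congr (_ + _).
  by apply: eq_bigl => r; rewrite subsetD1.
rewrite (reindex_onto (fun r => i |: r) (fun r => r :\ i)) /=; last first.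
  by move=> r /andP[_ ir]; rewrite setD1K.
apply: eq_bigl => r; rewrite setU11 andbT subsetD1 subUset sub1set iA /=.
congr (_ && _); apply/eqP/idP => [<-|/setU1K->//].
by rewrite !inE eqxx.
Qed.

(** * Multilinear maps and sums over subsets of the arguments *)

Lemma subst_set0 n T (x y : 'I_n -> T) : subst x set0 y = x.
Proof. by apply/funext => i; rewrite /subst inE. Qed.

Lemma subst_setT n T (x y : 'I_n -> T) : subst x setT y = y.
Proof. by apply/funext => i; rewrite /subst inE. Qed.

Section Multilinear.
Variables (R : pzRingType) (n : nat) (M N : lmodType R).
Variable g : ('I_n -> M) -> N.
Implicit Types (i : 'I_n) (r s A : {set 'I_n}) (u v w x y z : 'I_n -> M).

(** Linearity at i in relational form, for z that is only extensionally an
    update of x and y. *)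
Lemma linear_at_scaleD i a x y z : linear_at g i ->
    (forall j, j != i -> z j = x j) -> (forall j, j != i -> z j = y j) ->
  z i = a *: x i + y i -> g z = a *: g x + g y.
Proof.
move=> lin zx zy zi.
have upd t : (forall j, j != i -> z j = t j) -> t = [eta z with i |-> t i].
  by move=> zt; apply/funext => j /=; case: eqP => [->|/eqP/zt].
by rewrite (upd x zx) (upd y zy) -lin -zi -(upd z).
Qed.

Lemma linear_at0 i x : linear_at g i -> x i = 0 -> g x = 0.
Proof.
move=> lin xi; have := @linear_at_scaleD i 1 x x x lin.
rewrite xi scaler0 addr0 scale1r => /(_ _ _ erefl) e.
by apply: (addrI (g x)); rewrite addr0 -e.
Qed.

Lemma linear_atN i x y : linear_at g i ->
  (forall j, j != i -> y j = x j) -> y i = - x i -> g y = - g x.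
Proof.
move=> lin yx yi.
rewrite (@linear_at_scaleD i (-1) x [eta x with i |-> 0] y) //.
- by rewrite scaleN1r (@linear_at0 i [eta x with i |-> 0]) ?addr0 //= eqxx.
- by move=> j ji /=; rewrite (negPf ji) yx.
- by rewrite /= eqxx addr0 scaleN1r.
Qed.

Hypothesis lin : forall i, linear_at g i.

(** Generalization of [multilinear_expand] to sums placed in A only, which makes
    the induction on the cardinal of A possible. *)
Lemma multilinear_expand_in A w u v :
  g (subst w A (fun i => u i + v i)) =
  \sum_(r : {set 'I_n} | r \subset A) g (subst (subst w A u) r v).
Proof.
have [k] := ubnP #|A|; elim: k A w => // k IHk A w.
have [->|[i iA]] := set_0Vmem A.
  move=> _; rewrite (big_pred1 set0) => [|r]; last by rewrite subset0.
  by congr g; apply/funext => i; rewrite /subst !inE.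
rewrite (cardsD1 i) iA ltnS => Ak; rewrite (big_subset_setD1 _ iA).
pose D t := subst [eta w with i |-> t i] (A :\ i) (fun i => u i + v i).
rewrite (@linear_at_scaleD i 1 (D u) (D v)) //; first last.
- by rewrite /D /subst !inE eqxx iA /= eqxx scale1r.
- by move=> j /negPf ji; rewrite /D /subst !inE ji /= ji.
- by move=> j /negPf ji; rewrite /D /subst !inE ji /= ji.
rewrite scale1r /D !IHk //; congr (_ + _); apply: eq_bigr => r /subsetP rA;
  congr g; apply/funext => j; rewrite /subst !inE /=.
- have := rA j; rewrite !inE; case: eqP => [->|_] //=.
  by rewrite iA; case: (i \in r) => [/(_ isT)|].
- have := rA j; rewrite !inE; case: eqP => [->|_] //=.
  by case: (i \in r) => [/(_ isT)|].
Qed.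

Lemma multilinear_expand u v :
  g (fun i => u i + v i) = \sum_(r : {set 'I_n}) g (subst u r v).
Proof.
have := multilinear_expand_in setT u u v.
under eq_bigl do rewrite subsetT.
by rewrite !subst_setT.
Qed.

(** Negating the arguments in s multiplies the value by (-1)^|s|. *)
Lemma multilinear_opp x y s :
    (forall i, y i = if i \in s then - x i else x i) ->
  g y = (-1) ^+ #|s| *: g x.
Proof.
have [k] := ubnP #|s|; elim: k s y => // k IHk s y.
have [->|[i si]] := set_0Vmem s => [_ yE|].
  rewrite cards0 expr0 scale1r; congr g.
  by apply/funext => i; rewrite yE inE.
rewrite (cardsD1 i) si ltnS => sk yE.
rewrite add1n exprS -scalerA scaleN1r.
rewrite -(IHk (s :\ i) (fun j => if j \in s :\ i then - x j else x j)) //.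
apply: (@linear_atN i) => // [j ji|].
  by rewrite yE !inE ji.
by rewrite yE si !inE eqxx.
Qed.

(** The source of the signs in the definition of a coboundary: the terms for r
    not containing s vanish, and in the others -w occupies the places r \ s. *)
Lemma multilinear_expandB u w s x :
  g (subst (fun i => u i - w i) s x) =
  \sum_(r : {set 'I_n} | s \subset r)
     (-1) ^+ (#|r| - #|s|) *: g (subst u r (subst w s x)).
Proof.
have -> : subst (fun i => u i - w i) s x =
    fun i => subst u s (fun=> 0) i + subst (fun i => - w i) s x i.
  by apply/funext => i; rewrite /subst; case: ifP; rewrite ?add0r.
rewrite multilinear_expand (bigID (fun r => s \subset r)) /= addrC big1.
  rewrite add0r; apply: eq_bigr => r sr.
  rewrite -(setIidPr sr) -cardsD; apply: multilinear_opp => i.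
  rewrite (setIidPr sr) /subst !inE; have /implyP := subsetP sr i.
  by case: (i \in s); case: (i \in r).
move=> r /subsetPn[i si ir].
by apply: (@linear_at0 i); rewrite // /subst (negPf ir) si.
Qed.

End Multilinear.

(** A sum over sets of arguments, as a sum over [pset n] plus the two extreme
    terms; for n = 0 these would coincide. *)
Lemma big_pset (n : nat) (N : zmodType) (G : {set 'I_n} -> N)
    (P : pred {set 'I_n}) : (0 < n)%N -> P setT ->
  \sum_(r : {set 'I_n} | P r) G r =
  (if P set0 then G set0 else 0) + \sum_(r : pset n | P (val r)) G (val r)
  + G setT.
Proof.
move=> n_gt0 PT.
have neT : set0 != [set: 'I_n].
  by apply/eqP => /setP/(_ (Ordinal n_gt0)); rewrite !inE.
rewrite (bigD1 setT) //= addrC; congr (_ + _).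
rewrite (bigID (pred1 set0)) /=; congr (_ + _).
  case: ifP => P0.
    rewrite (big_pred1 set0) // => r /=.
    by case: (r =P set0) => [->|_]; rewrite ?P0 ?neT ?andbF.
  by apply: big_pred0 => r; case: (r =P set0) => [->|_]; rewrite ?P0 ?andbF.
rewrite -(big_sub_cond [pred s | (s != set0) && (s != setT)]).
by apply: eq_bigl => r; rewrite -andbA [RHS]andbC [(_ != setT) && _]andbC.
Qed.

(** * Homomorphisms and varieties *)

Section Homomorphisms.
Variables (R : pzRingType) (F : Type) (ar : F -> nat).
Implicit Types (A B C : alg R ar) (M N : malg R ar).

Lemma eval_hom A B (l : A -> B) env t :
  is_hom l -> l (eval env t) = eval (l \o env) t.
Proof.
case=> l0 lD lN lZ lop.
elim: t => [k||t IHt u IHu|t IHt|r t IHt|f ts IHts] //=.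
- by rewrite lD IHt IHu.
- by rewrite lN IHt.
- by rewrite lZ IHt.
- by rewrite lop; congr aop; apply/funext => i; exact: IHts.
Qed.

Lemma is_hom_comp A B C (k : B -> C) (l : A -> B) :
  is_hom k -> is_hom l -> is_hom (k \o l).
Proof.
by case=> k0 kD kN kZ kop [l0 lD lN lZ lop]; split=> * /=;
   rewrite ?(l0, lD, lN, lZ, lop).
Qed.

Lemma is_hom_inv A B (l : A -> B) (k : B -> A) :
  is_hom l -> cancel l k -> cancel k l -> is_hom k.
Proof.
case=> l0 lD lN lZ lop lK kK; split=> *; apply: (can_inj lK); rewrite kK.
- by rewrite l0.
- by rewrite lD !kK.
- by rewrite lN kK.
- by rewrite lZ kK.
- by rewrite lop; congr aop; apply/funext => i; rewrite kK.
Qed.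

Section UnderOver.
Variables (Q I : malg R ar).

Lemma isomorphic_under_over_sym A B (i : I -> A) (p : A -> Q) (j : I -> B)
    (q : B -> Q) :
  isomorphic_under_over i p j q -> isomorphic_under_over j q i p.
Proof.
case=> l [lhom [k lK kK] li lp]; exists k; split.
- exact: is_hom_inv lhom lK kK.
- by exists l.
- by move=> a; rewrite -li lK.
- by move=> m; rewrite -lp kK.
Qed.

Lemma isomorphic_under_over_trans A B C (i : I -> A) (p : A -> Q)
    (j : I -> B) (q : B -> Q) (k : I -> C) (r : C -> Q) :
  isomorphic_under_over i p j q -> isomorphic_under_over j q k r ->
  isomorphic_under_over i p k r.
Proof.
case=> l [lhom lbij li lp] [l' [l'hom l'bij l'j l'q]]; exists (l' \o l); split.
- exact: is_hom_comp.
- exact: bij_comp.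
- by move=> a; rewrite /= li.
- by move=> m; rewrite /= l'q.
Qed.

End UnderOver.

Section ModuleHomomorphism.
Variables (M N : malg R ar) (phi : M -> N).
Hypothesis phi_hom : is_hom (A := M) (B := N) phi.

Lemma hom0 : phi 0 = 0. Proof. exact: (hom_zero phi_hom). Qed.
Lemma homD x y : phi (x + y) = phi x + phi y.
Proof. exact: (hom_add phi_hom). Qed.
Lemma homN x : phi (- x) = - phi x. Proof. exact: (hom_opp phi_hom). Qed.
Lemma homB x y : phi (x - y) = phi x - phi y.
Proof. by rewrite homD homN. Qed.
Lemma homZ r x : phi (r *: x) = r *: phi x.
Proof. exact: (hom_scale phi_hom). Qed.
Lemma homM f (x : 'I_(ar f) -> M) : phi (mop x) = mop (fun i => phi (x i)).
Proof. exact: (hom_op phi_hom). Qed.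
Lemma hom_sum (T : finType) (P : pred T) (G : T -> M) :
  phi (\sum_(i | P i) G i) = \sum_(i | P i) phi (G i).
Proof. exact: (big_morph phi homD hom0). Qed.

End ModuleHomomorphism.

(** The axioms of modules and the multilinearity of the operations are
    identities, so an algebra satisfying all identities of the expanded modules
    is one of them. *)
Lemma malg_of_identities (C : choiceType) (z : C) (add : C -> C -> C)
    (opp : C -> C) (scale : R -> C -> C)
    (op : forall f : F, ('I_(ar f) -> C) -> C) :
  let A := @Alg R F ar C z add opp scale op in
  (forall e, Id (fun=> True) e -> satisfies A e) ->
  exists M : malg R ar, alg_of M = A.
Proof.
case: C z add opp scale op => C cl /= z add opp scale op.
set A := Alg _ _ _ _ _ => idA.
pose env3 (x y w : C) k : A :=
  if k is k'.+1 then (if k' is _.+1 then w else y) else x.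
pose X : term R ar := Var R ar 0; pose Y := Var R ar 1; pose W := Var R ar 2.
have addrA' : associative add.
  move=> x y w; apply: (idA (Add X (Add Y W), Add (Add X Y) W) _ (env3 x y w)).
  by move=> M _ env /=; rewrite addrA.
have addrC' : commutative add.
  move=> x y; apply: (idA (Add X Y, Add Y X) _ (env3 x y x)).
  by move=> M _ env /=; rewrite addrC.
have add0r' : left_id z add.
  move=> x; apply: (idA (Add (Zero R ar) X, X) _ (env3 x x x)).
  by move=> M _ env /=; rewrite add0r.
have addNr' : left_inverse z opp add.
  move=> x; apply: (idA (Add (Opp X) X, Zero R ar) _ (env3 x x x)).
  by move=> M _ env /=; rewrite addNr.
have scalerA' a b x : scale a (scale b x) = scale (a * b) x.
  apply: (idA (Scale a (Scale b X), Scale (a * b) X) _ (env3 x x x)).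
  by move=> M _ env /=; rewrite scalerA.
have scale1r' : left_id 1 scale.
  move=> x; apply: (idA (Scale 1 X, X) _ (env3 x x x)).
  by move=> M _ env /=; rewrite scale1r.
have scalerDr' : right_distributive scale add.
  move=> a x y.
  apply: (idA (Scale a (Add X Y), Add (Scale a X) (Scale a Y)) _ (env3 x y x)).
  by move=> M _ env /=; rewrite scalerDr.
have scalerDl' x a b : scale (a + b) x = add (scale a x) (scale b x).
  apply: (idA (Scale (a + b) X, Add (Scale a X) (Scale b X)) _ (env3 x x x)).
  by move=> M _ env /=; rewrite scalerDl.
pose zmod := GRing.isZmodule.Build (Choice.Pack cl) addrA' addrC' add0r' addNr'.
pose Z : zmodType := HB.pack C cl zmod.
pose lmod :=
  GRing.Zmodule_isLmodule.Build R Z scalerA' scale1r' scalerDr' scalerDl'.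
pose L : lmodType R := HB.pack C cl zmod lmod.
have opL f i : @linear_at R (ar f) L L (op f) i.
  move=> x a u v.
  (* the variables j < ar f stand for the x j, the next two for u and v *)
  pose env k : A :=
    if insub k is Some j then x j else if k == ar f then u else v.
  pose T w : term R ar :=
    Op (fun j : 'I_(ar f) => if j == i then w else Var R ar j).
  pose U := Var R ar (ar f); pose W' := Var R ar (ar f).+1.
  have envX (j : 'I_(ar f)) : env j = x j.
    by rewrite /env -[nat_of_ord j]/(val j) valK.
  have envU : env (ar f) = u by rewrite /env insubF ?ltnn ?eqxx.
  have envV : env (ar f).+1 = v.
    by rewrite /env insubF ?ltnNge ?leqW // eqn_leq ltnn.
  have evT w : eval (A := A) env (T w) =
      op f [eta x with i |-> eval (A := A) env w].
    rewrite /T /=; congr op; apply/funext => j /=.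
    by case: eqP => // _; exact: envX.
  have idT : Id (fun=> True)
      (T (Add (Scale a U) W'), Add (Scale a (T U)) (T W')).
    move=> M _ e; set y := fun j : 'I_(ar f) => e j.
    have evM w : eval (A := M) e (T w) =
        mop [eta y with i |-> eval (A := M) e w].
      by rewrite /T /=; congr mop; apply/funext => j /=; case: eqP.
    change (eval (A := M) e (T (Add (Scale a U) W')) =
      a *: eval (A := M) e (T U) + eval (A := M) e (T W')).
    by rewrite !evM; exact: mop_multilinear.
  have {idT} : eval (A := A) env (T (Add (Scale a U) W')) =
      add (scale a (eval (A := A) env (T U))) (eval (A := A) env (T W')).
    exact: idA _ idT env.
  by rewrite !evT /= envU envV.
by exists (MAlg opL).
Qed.

End Homomorphisms.

(** * Cocycles attached to a section *)

Lemma pset_neq0 n (s : pset n) : exists j, j \in val s.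
Proof. by apply/set0Pn; case: s => s /= /andP[]. Qed.

Lemma pset_neqT n (s : pset n) : exists j, j \notin val s.
Proof.
case: s => s /= /andP[_]; rewrite -subTset => /subsetPn[j _ js].
by exists j.
Qed.

Lemma subrACA (M : zmodType) (x y z t : M) : x - y - (z - t) = x - z - (y - t).
Proof. by rewrite !opprB [LHS]addrACA [RHS]addrACA (addrC (- y)). Qed.

Section Extensions.
Variables (R : pzRingType) (F : Type) (ar : F -> nat).
Hypothesis ar_gt0 : forall f : F, (0 < ar f)%N.
Variables (V : malg R ar -> Prop) (Q I : malg R ar).
Implicit Types (T : cochain Q I) (E : extension Q I V).

Lemma mop_eq0 (M : malg R ar) f (x : 'I_(ar f) -> M) i : x i = 0 -> mop x = 0.
Proof. exact: linear_at0 (mop_multilinear i). Qed.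

(** T measures how far the section [sigma] of an extension is from being a
    homomorphism.  Nothing needs to be required about opposites, since they are
    determined by the addition. *)
Record section_cocycle E (sigma : Q -> mid E) T : Prop := SectionCocycle {
  section0 : sigma 0 = 0;
  sectionK : forall x, proj (sigma x) = x;
  sectionD : forall x y,
    sigma x + sigma y = incl E (cadd T x y) + sigma (x + y);
  sectionZ : forall r x, r *: sigma x = incl E (cscale T r x) + sigma (r *: x);
  sectionM : forall f (x : 'I_(ar f) -> Q),
    mop (fun i => sigma (x i)) = incl E (cop T x) + sigma (mop x);
  section_act : forall f (s : pset (ar f)) (x : 'I_(ar f) -> Q)
      (a : 'I_(ar f) -> I),
    incl E (cact T s x a) =
    mop (subst (fun i => sigma (x i)) (val s) (fun i => incl E (a i)))
}.

(** The action term for s is the operation of I x|_T Q on pure elements, <a_j,0>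
    for j in s and <0,x_j> for j outside s: all other summands vanish. *)
Lemma rtimes_actE T f (s : pset (ar f)) x a : is_cocycle T ->
  @aop _ _ _ (rtimes T) f
    (fun i => (if i \in val s then a i else 0, if i \in val s then 0 else x i))
  = (cact T s x a, 0).
Proof.
move=> cT; have [j sj] := pset_neq0 s; have [k sk] := pset_neqT s.
rewrite /= (@mop_eq0 I _ _ k) ?(negPf sk) // add0r.
rewrite (@mop_eq0 Q _ _ j) ?sj // (cop0 cT) ?addr0.
  2: by exists j; rewrite sj.
congr pair; rewrite (bigD1 s) //= big1 ?addr0 => [|r rs].
  by apply: (cact_dep cT) => i; [move=> /negPf ->|move=> ->].
have [rsub|/subsetPn[i ir si]] := boolP (val r \subset val s).
  have /subsetPn[i si ir] : ~~ (val s \subset val r).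
    by apply: contra rs => sr; rewrite -val_eqE eqEsubset rsub.
  by apply: (cact0 cT); exists i; rewrite ?si.
by apply: (linear_at0 (cact_multilinear cT _ ir)); rewrite (negPf si).
Qed.

Lemma incl_inj E : injective (incl E).
Proof. exact: ext_incl_inj. Qed.

Lemma proj_incl E a : proj (incl E a) = 0.
Proof. by apply/ext_exact; exists a. Qed.

(** The inverse of the inclusion on the kernel of the projection; its value is
    irrelevant elsewhere. *)
Lemma exists_kernel_inverse E :
  exists k : mid E -> I, forall m, proj m = 0 -> incl E (k m) = m.
Proof.
have kP m : proj m = 0 -> exists a, incl E a == m.
  by move=> /ext_exact[a am]; exists a; apply/eqP.
exists (fun m => if proj m =P 0 is ReflectT m0 then xchoose (kP m m0) else 0).
by move=> m m0; case: eqP => // m0'; apply/eqP/(xchooseP (kP m m0')).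
Qed.

(** A cocycle realizes an extension iff it comes from one of its sections. *)
Lemma realizesP T E : is_cocycle T ->
  realizes T E <-> exists sigma : Q -> mid E, section_cocycle sigma T.
Proof.
move=> cT; have iH := ext_incl_hom E; have pH := ext_proj_hom E.
split=> [[l [lH lbij li lp]]|[sigma sT]].
  exists (fun x => l (0, x)).
  have lE a x : l (a, x) = incl E a + l (0, x).
    rewrite -li; have /= <- := hom_add lH (a, 0) (0, x).
    by rewrite /= (c0add cT) !addr0 add0r.
  split.
  - exact: (hom_zero lH).
  - by move=> x; rewrite lp.
  - move=> x y; rewrite -lE; have /= <- := hom_add lH (0, x) (0, y).
    by rewrite !add0r.
  - move=> r x; rewrite -lE; have /= <- := hom_scale lH r (0, x).
    by rewrite scaler0 add0r.
  - move=> f x; rewrite -lE; have /= <- := hom_op lH (fun i => (0, x i)).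
    rewrite (@mop_eq0 I _ _ (Ordinal (ar_gt0 f))) // add0r.
    rewrite big1 ?add0r // => s _; have [j sj] := pset_neq0 s.
    exact: (linear_at0 (cact_multilinear cT _ sj)).
  - move=> f s x a; rewrite -li -(rtimes_actE s x a cT) (hom_op lH).
    congr (@mop _ _ _ _ f); apply/funext => i; rewrite /subst.
    by case: ifP => _; rewrite ?li.
have s0 := section0 sT.
pose l (u : rtimes T) : mid E := incl E u.1 + sigma u.2.
have lE u : proj (l u) = u.2 by rewrite (homD pH) proj_incl add0r (sectionK sT).
have lD u v : l (aadd u v) = l u + l v.
  rewrite /l /= !(homD iH) addrACA (sectionD sT); rewrite !addrA; congr (_ + _).
(* expand f (sigma x + i a): the empty set gives the value at sigma x, the full
   set the value at i a, and the other sets the action terms *)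
have lM f (u : 'I_(ar f) -> rtimes T) : l (aop u) = mop (fun i => l (u i)).
  pose x i := (u i).2; pose a i := (u i).1.
  have -> : (fun i => l (u i)) = fun i => sigma (x i) + incl E (a i).
    by apply/funext => i; rewrite addrC.
  rewrite (multilinear_expand (mop_multilinear (f := f))).
  rewrite (@big_pset _ _ _ predT) //=.
  rewrite [l _]/= -/a -/x /l /= !(homD iH) (homM iH) (hom_sum iH).
  rewrite -[X in X = _]addrA -(sectionM sT).
  rewrite subst_set0 subst_setT [LHS]addrC -[RHS]addrA; congr (_ + _).
  rewrite addrC; congr (_ + _); apply: eq_bigr => s _; exact: (section_act sT).
have [k kE] := exists_kernel_inverse E.
exists l; split.
- split.
  + by rewrite /l /= s0 (hom0 iH) addr0.
  + exact: lD.
  + move=> u; apply: (addrI (l u)); rewrite -lD addrN /l /=.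
    by rewrite -(addrA u.1) subrK !subrr (hom0 iH) s0 addr0.
  + move=> r u; rewrite /l /= (homD iH) (homZ iH) scalerDr.
    by rewrite (sectionZ sT) addrA.
  + exact: lM.
- exists (fun m => (k (m - sigma (proj m)), proj m)) => [u|m].
    rewrite lE; apply: injective_projections => //=.
    apply: (@incl_inj E).
    rewrite kE; first by rewrite /l addrK.
    by rewrite (homB pH) lE (sectionK sT) subrr.
  by rewrite /l /= kE ?subrK // (homB pH) (sectionK sT) subrr.
- by move=> a; rewrite /l /= s0 addr0.
- exact: lE.
Qed.

Lemma exists_section E :
  exists2 sigma : Q -> mid E, sigma 0 = 0 & forall x, proj (sigma x) = x.
Proof.
have pH := ext_proj_hom E.
have sP x : exists m : mid E, proj m == x.
  by have [m mx] := ext_proj_surj E x; exists m; apply/eqP.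
exists (fun x => if x == 0 then 0 else xchoose (sP x)) => [|x].
  by rewrite eqxx.
case: eqP => [->|_]; first exact: (hom0 pH).
exact/eqP/(xchooseP (sP x)).
Qed.

(** Each normalized section of an extension gives rise to a cocycle. *)
Lemma exists_section_cocycle E (sigma : Q -> mid E) :
  sigma 0 = 0 -> (forall x, proj (sigma x) = x) ->
  exists2 T, is_cocycle T & section_cocycle sigma T.
Proof.
move=> s0 sK; have iH := ext_incl_hom E; have pH := ext_proj_hom E.
have [k kE] := exists_kernel_inverse E.
pose T : cochain Q I := {|
  cadd := fun x y => k (sigma x + sigma y - sigma (x + y));
  cscale := fun r x => k (r *: sigma x - sigma (r *: x));
  cop := fun f x => k (mop (fun i => sigma (x i)) - sigma (mop x));
  cact := fun f s x a =>
    k (mop (subst (fun i => sigma (x i)) (val s) (fun i => incl E (a i)))) |}.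
have sT : section_cocycle sigma T.
  split=> //=.
  - by move=> x y; rewrite kE ?subrK // (homB pH) (homD pH) !sK subrr.
  - by move=> r x; rewrite kE ?subrK // (homB pH) (homZ pH) !sK subrr.
  - move=> f x; rewrite kE ?subrK // (homB pH) (homM pH) !sK.
    by under eq_fun do rewrite sK; rewrite subrr.
  - move=> f s x a; rewrite kE // (homM pH).
    have [j sj] := pset_neq0 s.
    by apply: (@mop_eq0 Q _ _ j); rewrite /subst sj proj_incl.
exists T => //.
split=> [x|x|r|f x [i xi]|f s x x' a a' xx' aa'|f s x j sj b c u v
        |f s x a [j sj xj]];
  apply: (@incl_inj E).
- apply: (addIr (sigma (x + 0))).
  by rewrite -(sectionD sT) s0 addr0 (hom0 iH) add0r addr0.
- apply: (addIr (sigma (0 + x))).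
  by rewrite -(sectionD sT) s0 !add0r (hom0 iH) add0r.
- apply: (addIr (sigma (r *: 0))).
  by rewrite -(sectionZ sT) scaler0 s0 scaler0 (hom0 iH) add0r.
- apply: (addIr (sigma (mop x))); rewrite -(sectionM sT) (hom0 iH) add0r.
  by rewrite (mop_eq0 xi) s0 (@mop_eq0 _ _ _ i) // xi.
- rewrite !(section_act sT); congr (@mop _ _ _ _ f); apply/funext => i.
  by rewrite /subst; case: ifP => [/aa' -> //|/negbT/xx' ->].
- rewrite (homD iH) (homZ iH) !(section_act sT).
  apply: (linear_at_scaleD (mop_multilinear j)); rewrite /subst.
  + by move=> i /negPf ij /=; rewrite ij.
  + by move=> i /negPf ij /=; rewrite ij.
  + by rewrite sj /= eqxx (homD iH) (homZ iH).
- rewrite (section_act sT) (hom0 iH); apply: (@mop_eq0 _ _ _ j).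
  by rewrite /subst (negPf sj) xj.
Qed.

Lemma cochain_ext T T' :
    (forall x y, cadd T x y = cadd T' x y) ->
    (forall r x, cscale T r x = cscale T' r x) ->
    (forall f (x : 'I_(ar f) -> Q), cop T x = cop T' x) ->
    (forall f (s : pset (ar f)) x a, cact T s x a = cact T' s x a) ->
  T = T'.
Proof.
case: T T' => tD tZ tM tA [tD' tZ' tM' tA'] /= eD eZ eM eA.
congr Cochain; first by apply/funext => x; exact/funext.
- by apply/funext => r; exact/funext.
- by apply: functional_extensionality_dep => f; exact/funext.
- apply: functional_extensionality_dep => f; apply/funext => s.
  by apply/funext => x; exact/funext.
Qed.

Lemma cochain_subI T : injective (cochain_sub T).
Proof.
move=> T1 T2 e; apply: cochain_ext => [x y|r x|f x|f s x a].
- by have /addrI/oppr_inj := congr1 (fun G => cadd G x y) e.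
- by have /addrI/oppr_inj := congr1 (fun G => cscale G r x) e.
- by have /addrI/oppr_inj := congr1 (fun G => cop G x) e.
- by have /addrI/oppr_inj := congr1 (fun G => cact G s x a) e.
Qed.

(** * Changing the section *)

Section ChangeOfSection.
Variables (E : extension Q I V) (sigma sigma' : Q -> mid E) (h : Q -> I).
Hypothesis hE : forall x, incl E (h x) = sigma x - sigma' x.
Variables (T T' : cochain Q I).
Hypothesis sT : section_cocycle sigma T.
Hypothesis sT' : section_cocycle sigma' T'.

Let iH := ext_incl_hom E.

(** The left-hand side is f (sigma' x) if s is empty, and the action term of
    sigma' for s if s is proper and nonempty; it is expanded along sigma. *)
Lemma mop_change_section f (s : {set 'I_(ar f)}) (x : 'I_(ar f) -> Q)
    (a : 'I_(ar f) -> I) (b := subst (fun i => h (x i)) s a) :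
  mop (subst (fun i => sigma' (x i)) s (fun i => incl E (a i))) =
  (if s == set0 then mop (fun i => sigma (x i)) else 0) +
  \sum_(r : pset (ar f) | s \subset val r)
     (-1) ^+ (#|val r| - #|s|) *: incl E (cact T r x b) +
  (-1) ^+ (ar f - #|s|) *: incl E (mop b).
Proof.
have -> : (fun i => sigma' (x i)) = fun i => sigma (x i) - incl E (h (x i)).
  by apply/funext => i; rewrite hE subKr.
rewrite (multilinear_expandB (mop_multilinear (f := f))).
rewrite (@big_pset _ _ _ (fun r => s \subset r)) ?subsetT //=.
have -> : subst (fun i => incl E (h (x i))) s (fun i => incl E (a i)) =
    fun i => incl E (b i).
  by apply/funext => i; rewrite /b /subst; case: ifP.
rewrite subset0 cards0 sub0n scale1r subst_set0.
rewrite subst_setT cardsT card_ord (homM iH).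
do 2 congr (_ + _); apply: eq_bigr => r _.
by rewrite (section_act sT).
Qed.

(** Two cocycles of the same extension differ by the coboundary of the
    difference of their sections, along the action terms of the first. *)
Lemma section_cocycle_sub : cochain_sub T T' = coboundary (cact T) h.
Proof.
apply: cochain_ext => [x y|r x|f x|f s x a] /=; apply: (@incl_inj E).
- rewrite !(homB iH) (homD iH) !hE.
  have -> : incl E (cadd T x y) = sigma x + sigma y - sigma (x + y).
    by rewrite (sectionD sT) addrK.
  have -> : incl E (cadd T' x y) = sigma' x + sigma' y - sigma' (x + y).
    by rewrite (sectionD sT') addrK.
  by rewrite subrACA opprD [sigma x + _ + _]addrACA.
- rewrite !(homB iH) (homZ iH) !hE.
  have -> : incl E (cscale T r x) = r *: sigma x - sigma (r *: x).
    by rewrite (sectionZ sT) addrK.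
  have -> : incl E (cscale T' r x) = r *: sigma' x - sigma' (r *: x).
    by rewrite (sectionZ sT') addrK.
  by rewrite scalerBr subrACA.
- rewrite !(homB iH) (homD iH) (homZ iH) (hom_sum iH) hE.
  have -> : incl E (cop T x) = mop (fun i => sigma (x i)) - sigma (mop x).
    by rewrite (sectionM sT) addrK.
  have -> : incl E (cop T' x) = mop (fun i => sigma' (x i)) - sigma' (mop x).
    by rewrite (sectionM sT') addrK.
  have := mop_change_section set0 x (fun=> 0).
  rewrite !subst_set0 eqxx cards0 subn0 => ->.
  under eq_bigl do rewrite sub0set.
  under eq_bigr do rewrite subn0.
  under [in RHS]eq_bigr do rewrite (homZ iH) add1n exprS mulN1r scaleNr.
  rewrite sumrN add1n exprS mulN1r scaleNr.
  set A := mop _; set B := \sum_r _; set D := _ *: _.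
  by rewrite subrACA -[A + B + D]addrA opprD addNKr opprD.
- rewrite (homB iH) (homD iH) (homZ iH) (hom_sum iH) (section_act sT').
  rewrite mop_change_section.
  set b := subst _ _ a.
  have /negPf -> : val s != set0 by have /set0Pn := pset_neq0 s.
  (* the term for r = s is the action term of T itself *)
  rewrite add0r (bigD1 s) //= subnn scale1r.
  have -> : cact T s x b = cact T s x a.
    apply: (@incl_inj E); rewrite !(section_act sT); congr (@mop _ _ _ _ f).
    by apply/funext => i; rewrite /b /subst; case: ifP => // ->.
  rewrite !opprD !addrA subrr add0r -sumrN -scaleNr; congr (_ + _).
    apply: eq_big => [r|r /andP[sr _]].
      by rewrite properEneq andbC eq_sym val_eqE.
    by rewrite (homZ iH) -addnBA ?subset_leq_card // add1n exprS mulN1r scaleNr.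
  rewrite -addnBA ?add1n ?exprS ?mulN1r //.
  by rewrite -[leqRHS]card_ord max_card.
Qed.

End ChangeOfSection.

Lemma section_cocycle_equiv E (sigma sigma' : Q -> mid E) T T' :
  section_cocycle sigma T -> section_cocycle sigma' T' -> cochain_equiv T T'.
Proof.
move=> sT sT'; have [k kE] := exists_kernel_inverse E.
have iH := ext_incl_hom E; have pH := ext_proj_hom E.
pose h x := k (sigma x - sigma' x).
have hE x : incl E (h x) = sigma x - sigma' x.
  by rewrite kE // (homB pH) (sectionK sT) (sectionK sT') subrr.
exists h; split; last exact: section_cocycle_sub hE _ _ sT sT'.
apply: (@incl_inj E).
by rewrite hE (section0 sT) (section0 sT') subrr (hom0 iH).
Qed.

(** All cocycles equivalent to that of a section come from other sections of the
    same extension, namely sigma - i o h. *)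
Lemma cochain_equiv_section E (sigma : Q -> mid E) T T' :
  section_cocycle sigma T -> cochain_equiv T T' ->
  exists sigma' : Q -> mid E, section_cocycle sigma' T'.
Proof.
move=> sT [h [h0 TT']]; have iH := ext_incl_hom E; have pH := ext_proj_hom E.
pose sigma' x := sigma x - incl E (h x).
have [||T2 _ sT2] := @exists_section_cocycle E sigma'.
- by rewrite /sigma' (section0 sT) h0 (hom0 iH) subrr.
- by move=> x; rewrite (homB pH) (sectionK sT) proj_incl subr0.
(* the cocycle T2 of sigma' has the same difference to T as T' *)
exists sigma'; suff -> : T' = T2 by [].
apply: (@cochain_subI T); rewrite TT'; apply/esym.
by apply: section_cocycle_sub sT sT2 => x; rewrite subKr.
Qed.

End Extensions.

(** * Compatible cocycles and members of the variety *)

Section Classification.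
Variables (R : pzRingType) (F : Type) (ar : F -> nat).
Hypothesis ar_gt0 : forall f : F, (0 < ar f)%N.
Variables (V : malg R ar -> Prop) (Q I : malg R ar).
Hypotheses (VQ : V Q) (VI : V I).
Implicit Types (T : cochain Q I) (E : extension Q I V).

Lemma realizes_compatible T E : realizes T E -> compatible V T.
Proof.
case=> l [lH [k lK _] _ _] e eV a q; congr (_.1 - _); last exact: eV VI _.
apply: (can_inj lK); rewrite !(eval_hom _ _ lH).
exact: eV (ext_mid E) _.
Qed.

Lemma eval_rtimes_snd T (env : nat -> rtimes T) t :
  (eval env t).2 = eval (A := Q) (fun k => (env k).2) t.
Proof. by apply: (@eval_hom _ _ _ (rtimes T) Q snd); split. Qed.

(** Compatibility controls the first coordinate of the value of a term, and the
    second coordinate is computed in Q. *)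
Lemma compatible_satisfies T e :
  compatible V T -> Id V e -> satisfies (rtimes T) e.
Proof.
move=> Tc eV env; apply: injective_projections.
  have -> : env = fun k => ((env k).1, (env k).2).
    by apply/funext => k; case: (env k).
  have := Tc e eV (fun k => (env k).1) (fun k => (env k).2).
  by rewrite /Dterm (eV I VI) => /addIr.
by rewrite !eval_rtimes_snd; exact: eV VQ _.
Qed.

Lemma extension_of_alg (A : alg R ar) (i : I -> A) (p : A -> Q) :
    (exists2 M : malg R ar, V M & alg_of M = A) ->
    is_hom (A := I) i -> is_hom (B := Q) p ->
    injective i -> (forall m, p m = 0 <-> exists a, i a = m) ->
    (forall x, exists m, p m = x) ->
  exists E,
    isomorphic_under_over (M' := mid E) i p (incl E) (@proj _ _ _ _ _ _ E).
Proof.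
case=> M VM MA; case: A / MA i p => i p iH pH iI ex ps.
exists (Extension VM iH pH iI ex ps), id; split=> //.
by exists id.
Qed.

Lemma exists_realization (V_variety : is_variety V) T :
  is_cocycle T -> compatible V T -> exists E, realizes T E.
Proof.
move=> cT Tc; apply: extension_of_alg.
- have [M MT] : exists M : malg R ar, alg_of M = rtimes T.
    apply: malg_of_identities => e idE.
    by apply: compatible_satisfies => // A _; exact: idE.
  exists M => //; have [Eq EqP] := V_variety.
  apply/EqP => e Ee; rewrite MT; apply: compatible_satisfies => // A VA.
  by have /EqP := VA; exact.
- split=> /= [|a b|a|r a|f a].
  + by [].
  + by rewrite (cadd0 cT) !addr0.
  + by rewrite oppr0 (cadd0 cT) subr0.
  + by rewrite (cscale0 cT) addr0 scaler0.
  + have i0 : 'I_(ar f) by exact: Ordinal (ar_gt0 f).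
    rewrite (@mop_eq0 _ _ _ Q _ _ i0) // (cop0 cT) ?addr0; last by exists i0.
    rewrite big1 ?addr0 // => s _; apply: (cact0 cT).
    by have [j sj] := pset_neqT s; exists j.
- by split.
- by move=> a b [].
- move=> [a x] /=; split=> [->|[b [_ <-]]//]; by exists a.
- by move=> x; exists (0, x).
Qed.

End Classification.

(** * The classification of extensions *)

Theorem theorem3p24 (R : pzRingType) (F : Type) (ar : F -> nat)
    (ar_gt0 : forall f : F, is_true (0 < ar f)%N)
    (V : malg R ar -> Prop) (V_variety : is_variety V)
    (Q I : malg R ar) (VQ : V Q) (VI : V I) :
  exists phi : extension_classes Q I V -> H2 Q I V,
    [/\ bijective phi,
        (forall (E : extension Q I V) (T : compatible_cocycle Q I V),
           phi (extension_class E) = cohomology_class T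
           <-> realizes T E)
      & (forall E : extension Q I V,
           is_semidirect E <->
           exists T : compatible_cocycle Q I V,
             only_action_terms T /\
             phi (extension_class E) = cohomology_class T)].
Proof.
have realP (T : compatible_cocycle Q I V) E :=
  @realizesP _ _ _ ar_gt0 V _ _ _ E (cocycleP T).
have realize_section (E : extension Q I V) (sigma : Q -> mid E) T :
    is_cocycle T -> section_cocycle sigma T ->
    exists2 T' : compatible_cocycle Q I V, cocycle T' = T & realizes T' E.
  move=> cT sT; have TE : realizes T E.
    by apply/(realizesP ar_gt0 E cT); exists sigma.
  by exists (CompatibleCocycle cT (realizes_compatible VI TE)).
have [|T||E T TE T'|phi [phi_bij phiP]] := @quotient_bijection _ _
  (@extension_equiv _ _ _ Q I V) (@cocycle_equiv _ _ _ Q I V)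
  (fun E T => realizes T E).
- move=> E; have [sigma s0 sK] := exists_section E.
  have [T cT sT] := exists_section_cocycle s0 sK.
  by have [T' _ T'E] := realize_section E sigma T cT sT; exists T'.
- exact: exists_realization (cocycleP T) (cocycle_compatible T).
- move=> E T TE E'; split=> [TE'|EE'].
    exact: isomorphic_under_over_trans (isomorphic_under_over_sym TE) TE'.
  exact: isomorphic_under_over_trans TE EE'.
- have /realP[sigma sT] := TE; split=> [/realP[sigma' sT']|TT'].
    exact: section_cocycle_equiv sT sT'.
  by apply/realP; exact: cochain_equiv_section sT TT'.
exists phi; split=> // E; split=> [[l [lH lK]]|[T [[TD0 TZ0 TM0]]]].
  have [T cT sT] := exists_section_cocycle (hom0 lH) lK.
  have [T' eT T'E] := realize_section E l T cT sT.
  exists T'; split; last exact/phiP.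
  have iH := ext_incl_hom E; rewrite eT.
  split=> [x y|r x|f x]; apply: (@incl_inj _ _ _ _ _ _ E); rewrite (hom0 iH).
  - by apply: (addIr (l (x + y))); rewrite add0r -(sectionD sT) (homD lH).
  - by apply: (addIr (l (r *: x))); rewrite add0r -(sectionZ sT) (homZ lH).
  - by apply: (addIr (l (mop x))); rewrite add0r -(sectionM sT) (homM lH).
move=> /phiP/realP[sigma sT]; have iH := ext_incl_hom E.
exists sigma; split; last exact: sectionK sT.
have sD x y : sigma (x + y) = sigma x + sigma y.
  by rewrite (sectionD sT) TD0 (hom0 iH) add0r.
split=> /= [|x y|x|r x|f x].
- exact: section0 sT.
- exact: sD.
- by apply: (addrI (sigma x)); rewrite -sD !subrr (section0 sT).
- by rewrite (sectionZ sT) TZ0 (hom0 iH) add0r.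
- by rewrite (sectionM sT) TM0 (hom0 iH) add0r.
Qed.
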